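(* Let $G=(V,E)$ be a finite bipartite graph with color classes $F$ and $W$, let $b:E\to\mathbb{R}_+$ be edge capacities and $q:V\to\mathbb{R}_+$ vertex quotas, and let every vertex $v\in V$ be endowed with the diversifying choice function $C_v$ determined by $q(v)$. Then the set $\mathcal{S}$ of stable assignments for $(G,b,q,C)$ consists of exactly one element.
   Context: $\mathbb{R}_+$ denotes the nonnegative reals. No relations between capacities and quotas are imposed. For $v\in V$, $E_v$ is the set of edges incident to $v$. For a real function $f$ on a finite set, $|f|$ denotes the sum of absolute values of $f$ over that set. The symbol $\wedge$ denotes minimum. The set of admissible assignments is $\mathcal{B}=\{x\in\mathbb{R}_+^E : x(e)\le b(e)\ \forall e\in E\}$. For $x\in\mathcal{B}$ and $v\in V$, $x_v$ is the restriction of $x$ to $E_v$, and $\mathcal{B}_v=\{x_v : x\in\mathcal{B}\}$. Diversifying choice function $C_v:\mathcal{B}_v\to\mathcal{B}_v$: for $z\in\mathcal{B}_v$, if $|z|\le q(v)$ then $C_v(z)=z$; if $|z|>q(v)$, take the number $r\ge 0$ with $\sum_{e\in E_v} (r\wedge z(e))=q(v)$ and put $C_v(z)(e)=r\wedge z(e)$ for $e\in E_v$. Rationality: $\mathcal{A}_v=\{z\in\mathcal{B}_v : C_v(z)=z\}$; an assignment $x\in\mathcal{B}$ is rational if $x_v\in\mathcal{A}_v$ for all $v\in V$. Head and upper-bound set: for $z\in\mathcal{A}_v$, if $|z|=q(v)$ ($z$ is fully filling), the head is $H(z)=\{e\in E_v : z(e)=\max_{e'\in E_v}z(e')\}$;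 if $|z|<q(v)$, put $H(z)=\emptyset$. Let $U(z)=\{e\in E_v : z(e)=b(e)\}$. An edge $e\in E_v$ is satiated for $v$ with respect to $z$ if $e\in H(z)\cup U(z)$. Stability: for a rational assignment $x$, an edge $e$ with ends $i,j$ is blocking for $x$ if $e$ is non-satiated both for $i$ with respect to $x_i$ and for $j$ with respect to $x_j$. A rational assignment $x$ is stable if there is no blocking edge for $x$. *)

(* Defs.v *)
From mathcomp Require Import all_boot all_order all_algebra.
From mathcomp Require Import classical_sets reals.

Set Implicit Arguments.
Unset Strict Implicit.
Unset Printing Implicit Defensive.
Import Order.TTheory GRing.Theory Num.Theory.
Local Open Scope ring_scope.

(* A finite simple graph is given by its set of edges, each edge being the
   two-element set of its ends. *)
Definition bipartite (V : finType) (E : {set {set V}}) (F W : {set V}) : Prop :=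
  [/\ [disjoint F & W], F :|: W = [set: V]%SET
    & forall e, e \in E -> exists i j, [/\ i \in F, j \in W & e = [set i; j]%SET]].

Definition edge (V : finType) (E : {set {set V}}) : finType :=
  {e : {set V} | e \in E}.

Definition ends (V : finType) (E : {set {set V}}) (e : edge E) : {set V} :=
  sval e.

Definition star (V : finType) (E : {set {set V}}) (v : V) : finType :=
  {e : edge E | v \in ends e}.

Definition star_edge (V : finType) (E : {set {set V}}) (v : V)
    (e : star E v) : edge E :=
  sval e.

Definition in_star (V : finType) (E : {set {set V}}) (v : V) (e : edge E)
    (ev : v \in ends e) : star E v :=
  exist _ e ev.

Definition norm1 (R : realType) (T : finType) (f : {ffun T -> R}) : R :=
  \sum_e `|f e|.

Definition admissible (R : realType) (V : finType) (E : {set {set V}})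
    (b : edge E -> R) : set {ffun edge E -> R} :=
  [set x | forall e, 0 <= x e <= b e]%classic.

Definition restr (R : realType) (V : finType) (E : {set {set V}}) (v : V)
    (x : {ffun edge E -> R}) : {ffun star E v -> R} :=
  [ffun e => x (star_edge e)].

Definition admissible_at (R : realType) (V : finType) (E : {set {set V}})
    (b : edge E -> R) (v : V) : set {ffun star E v -> R} :=
  [set restr v x | x in admissible b]%classic.
Arguments admissible_at {R V E} b v _.

(* For admissible z with |z| > q v >= 0 such a level exists and is unique; the
   default value 0 is never used. *)
Definition cut_level (R : realType) (V : finType) (E : {set {set V}})
    (q : V -> R) (v : V) (z : {ffun star E v -> R}) : R :=
  xget 0 [set r | 0 <= r /\ \sum_e Num.min r (z e) = q v]%classic.

Definition choice_fun (R : realType) (V : finType) (E : {set {set V}})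
    (q : V -> R) (v : V) (z : {ffun star E v -> R}) : {ffun star E v -> R} :=
  if norm1 z <= q v then z else [ffun e => Num.min (cut_level q z) (z e)].

Definition acceptable (R : realType) (V : finType) (E : {set {set V}})
    (b : edge E -> R) (q : V -> R) (v : V) : set {ffun star E v -> R} :=
  [set z | admissible_at b v z /\ choice_fun q z = z]%classic.
Arguments acceptable {R V E} b q v _.

Definition rational (R : realType) (V : finType) (E : {set {set V}})
    (b : edge E -> R) (q : V -> R) (x : {ffun edge E -> R}) : Prop :=
  admissible b x /\ forall v, acceptable b q v (restr v x).

(* Only used for acceptable z, hence nonnegative ones, so that 0 is a harmless
   unit for the maximum. *)
Definition head_set (R : realType) (V : finType) (E : {set {set V}})
    (q : V -> R) (v : V) (z : {ffun star E v -> R}) : {set star E v} :=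
  if norm1 z == q v then [set e | z e == \big[Num.max/0]_e' z e']%SET else finset.set0.

Definition upper_set (R : realType) (V : finType) (E : {set {set V}})
    (b : edge E -> R) (v : V) (z : {ffun star E v -> R}) : {set star E v} :=
  [set e | z e == b (star_edge e)]%SET.

Definition satiated (R : realType) (V : finType) (E : {set {set V}})
    (b : edge E -> R) (q : V -> R) (v : V) (z : {ffun star E v -> R})
    (e : star E v) : bool :=
  e \in head_set q z :|: upper_set b z.

Definition blocking (R : realType) (V : finType) (E : {set {set V}})
    (b : edge E -> R) (q : V -> R) (x : {ffun edge E -> R}) (e : edge E) : Prop :=
  exists (i j : V) (ei : i \in ends e) (ej : j \in ends e),
    [/\ ends e = [set i; j]%SET,
        ~~ satiated b q (restr i x) (in_star ei)
      & ~~ satiated b q (restr j x) (in_star ej)].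

Definition stable_assignments (R : realType) (V : finType) (E : {set {set V}})
    (b : edge E -> R) (q : V -> R) : set {ffun edge E -> R} :=
  [set x | rational b q x /\ ~ exists e, blocking b q x e]%classic.

(* Main.v *)
Require Import Defs.
From mathcomp Require Import all_boot all_order all_algebra.
From mathcomp Require Import classical_sets reals.
Import Order.TTheory GRing.Theory Num.Theory.
Local Open Scope ring_scope.

(** A rational assignment is an assignment below the capacities whose total at
    each vertex respects the quota, and an edge is satiated at an end [v]
    exactly when it is at capacity or [v] is a bottleneck for it: the quota of
    [v] is exhausted and no edge at [v] carries more. So [stable_fair] identifies
    the stable assignments with the max-min fair allocations, those in which
    every edge is at capacity or has a bottleneck. Max-min fair allocations
    exist and are unique for every incidence relation between two finite types;
    the graph enters only through the two ends of each edge.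

    Uniqueness ([fair_uniq]): if [x] and [y] are fair and differ, take an edge
    [e] where they differ with [min (x e) (y e)] smallest, say [x e < y e]. Then
    [e] is below capacity in [x], so it has a bottleneck [v]. Each [f] at [v] has
    [x f <= x e], and [y f < x f] would contradict the choice of [e]; hence
    [x <= y] at [v], strictly at [e], and [y] exceeds the quota of [v].

    Existence ([fair_exists]): progressive filling. Start from [0] and raise all
    values at the same speed, freezing an edge when it reaches its capacity or
    when the quota of one of its ends is exhausted. The edges still rising carry
    the largest value in the whole allocation, so a vertex whose quota becomes
    exhausted is a bottleneck for the edges it freezes, and stays one because all
    its edges are then frozen. Each round freezes at least one more edge.

    The water level defining the diversifying choice function exists by the same
    theorem, applied to a single vertex ([cut_level_exists]). *)

(** * Max-min fair allocations *)

Section FairFilling.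
Set Implicit Arguments.
Unset Strict Implicit.
Context {R : realFieldType} {T V : finType}.
Variables (inc : V -> pred T) (b : T -> R) (q : V -> R).
Implicit Types (x y : T -> R) (e f : T) (v : V) (t d : R).

Definition load x v := \sum_(e | inc v e) x e.

Definition feasible x :=
  (forall e, 0 <= x e <= b e) /\ (forall v, load x v <= q v).

Definition bottleneck x v e :=
  [/\ inc v e, load x v = q v & forall f, inc v f -> x f <= x e].

Definition fair x :=
  feasible x /\ forall e, x e = b e \/ exists v, bottleneck x v e.

(** This is the descent behind uniqueness: without a disagreement below
    the level [x e], [y] would dominate [x] around the bottleneck of [e] and
    overfill it. *)
Lemma fair_diff_descent x y e :
  fair x -> feasible y -> x e < y e ->
  exists2 f, x f != y f & Num.min (x f) (y f) < x e.
Proof.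
move=> [_ fx] [yb yq] xy.
case: (pickP [pred f | (x f != y f) && (Num.min (x f) (y f) < x e)]) => [f|no].
  by case/andP=> ? ?; exists f.
case: (fx e) => [xb|[v [ve xq xmax]]].
  by have /andP[_] := yb e; rewrite -xb leNgt xy.
have le f : inc v f -> x f <= y f.
  move=> vf; rewrite leNgt; apply/negP => yx; have := no f.
  by rewrite /= gt_eqF //= (min_r (ltW yx)) (lt_le_trans yx (xmax f vf)).
suff: load x v < load y v by rewrite xq ltNge yq.
rewrite /load (bigD1 e) //= [ltRHS](bigD1 e) //=.
by apply: ltr_leD => //; apply: ler_sum => f /andP[/le].
Qed.

Lemma fair_uniq x y : fair x -> fair y -> x =1 y.
Proof.
move=> fx fy e0; apply/eqP/negPn/negP => ne0.
pose m f := Num.min (x f) (y f).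
case: (@arg_minP _ _ T e0 (fun f => x f != y f) m ne0) => e ne emin.
have [xy|yx|xy] := ltgtP (x e) (y e); last by rewrite xy eqxx in ne.
  have [f nf] := fair_diff_descent fx (proj1 fy) xy.
  by rewrite ltNge -[x e](min_l (ltW xy)) (emin f nf).
have [f nf] := fair_diff_descent fy (proj1 fx) yx.
by rewrite minC ltNge -[y e](min_r (ltW yx)) emin 1?eq_sym.
Qed.

(** * Progressive filling *)

(** An edge is frozen when raising its value alone would break feasibility. *)
Definition frozen x e := (x e == b e) || [exists v, inc v e && (load x v == q v)].

(** The invariant of progressive filling at level [t]. *)
Definition filled x t :=
  [/\ feasible x, forall e, x e <= t, forall e, ~~ frozen x e -> x e = t
    & forall e, frozen x e -> x e = b e \/ exists v, bottleneck x v e].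

Definition raise x d e := if frozen x e then x e else x e + d.

Definition rising x v := #|[pred e | inc v e && ~~ frozen x e]|.

Lemma load_raise x d v : load (raise x d) v = load x v + d *+ rising x v.
Proof.
rewrite -sumr_const /load !(bigID (frozen x) (inc v)) /= -addrA; congr (_ + _).
  by apply: eq_bigr => e /andP[_ be]; rewrite /raise be.
rewrite -big_split; apply: eq_bigr => e /andP[_ /negbTE be].
by rewrite /raise be.
Qed.

(** A vertex whose quota is exhausted has only frozen edges, so its load does
    not change any more. *)
Lemma frozen_raise x d e : frozen x e -> frozen (raise x d) e.
Proof.
move=> be; case/orP: (be) => [xb|/existsP[v /andP[ve /eqP xq]]]; apply/orP.
  by left; rewrite /raise be.
right; apply/existsP; exists v; rewrite ve load_raise xq.
suff -> : rising x v = 0%N by rewrite mulr0n addr0 eqxx.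
apply: eq_card0 => f; rewrite inE; apply/andP => -[vf].
by case/orP; right; apply/existsP; exists v; rewrite vf xq eqxx.
Qed.

(** The bound [x e <= t] is what turns an exhausted vertex into a bottleneck: an
    edge frozen in this round has the value [t + d], the largest one of all. *)
Lemma filled_raise x t d :
  filled x t -> 0 <= d -> feasible (raise x d) -> filled (raise x d) (t + d).
Proof.
move=> [[xb xq] xt xf xB] d0 feas.
have le e : raise x d e <= t + d.
  rewrite /raise; case: ifP => _; last by rewrite lerD2r.
  by rewrite (le_trans (xt e)) // lerDl.
split=> // e.
  by move/(contra (@frozen_raise x d e)) => nb; rewrite /raise (negbTE nb) xf.
have [be _|nb] := boolP (frozen x e).
  have re : raise x d e = x e by rewrite /raise be.
  rewrite re; case: (xB e be) => [|[v [ve vq vmax]]]; [by left | right].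
  have bv f : inc v f -> frozen x f.
    by move=> vf; apply/orP; right; apply/existsP; exists v; rewrite vf vq eqxx.
  exists v; split=> // [|f vf]; last by rewrite re /raise bv //; exact: vmax.
  by rewrite -vq; apply: eq_bigr => f /bv; rewrite /raise => ->.
have re : raise x d e = t + d by rewrite /raise (negbTE nb) xf.
case/orP => [/eqP|/existsP[v /andP[ve /eqP vq]]]; [by left | right].
by exists v; split=> // f _; rewrite re.
Qed.

(** The increment is the largest feasible one: the minimum, over the rising
    edges and over the vertices with a rising edge, of the amount after which
    the capacity, respectively the quota, is reached. The constraint attaining
    the minimum freezes a new edge. *)
Lemma raise_step x e0 : feasible x -> ~~ frozen x e0 ->
  exists d, [/\ 0 <= d, feasible (raise x d)
    & exists2 e, ~~ frozen x e & frozen (raise x d) e].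
Proof.
move=> [xb xq] nb0.
pose active (k : T + V) :=
  match k with inl e => ~~ frozen x e | inr v => (0 < rising x v)%N end.
pose room (k : T + V) :=
  match k with
  | inl e => b e - x e
  | inr v => (q v - load x v) / (rising x v)%:R
  end.
case: (@arg_minP _ _ _ (inl e0) active room nb0) => k ak kmin.
have k0 : 0 <= room k.
  case: k {ak kmin} => [e|v] /=; last by rewrite divr_ge0 ?ler0n // subr_ge0.
  by rewrite subr_ge0; case/andP: (xb e).
exists (room k); split=> //.
- split=> [e|v].
    rewrite /raise; case: ifP => [_|/negbT nb]; first exact: xb.
    have /andP[x0 _] := xb e.
    by rewrite addr_ge0 //= addrC -lerBrDr (kmin (inl e)).
  rewrite load_raise; case: (posnP (rising x v)) => [->|n0].
    by rewrite mulr0n addr0.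
  rewrite addrC -lerBrDr -mulr_natr -ler_pdivlMr ?ltr0n //.
  exact: (kmin (inr v)).
- case: k ak {k0 kmin} => [e|v] /= ak.
    exists e => //; apply/orP; left.
    by rewrite /raise (negbTE ak) addrC subrK.
  have /card_gt0P[e] := ak; rewrite inE => /andP[ve nb].
  exists e => //; apply/orP; right; apply/existsP; exists v; rewrite ve.
  rewrite load_raise -[_ *+ _]mulr_natr divfK ?pnatr_eq0 -?lt0n //.
  by rewrite addrC subrK eqxx.
Qed.

Hypotheses (b_ge0 : forall e, 0 <= b e) (q_ge0 : forall v, 0 <= q v).

Lemma fair_exists : exists x, fair x.
Proof.
suff: forall n x t, (#|[pred e | ~~ frozen x e]| <= n)%N -> filled x t ->
    exists y, fair y.
  move/(_ _ (fun=> 0) 0 (leqnn _)); apply; split=> //.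
    split=> [e|v]; first by rewrite lexx b_ge0.
    by rewrite /load big1.
  move=> e; case/orP => [/eqP|/existsP[v /andP[ve /eqP vq]]]; [by left | right].
  by exists v.
elim=> [|n IH] x t.
  rewrite leqn0 => /eqP /card0_eq all_b [feas _ _ xB].
  exists x; split=> // e; apply: xB; apply/negPn/negP => nb.
  by have := all_b e; rewrite inE nb.
move=> card_le xf; have [feas _ _ xB] := xf.
case: (pickP (fun e => ~~ frozen x e)) => [e0 nb0|all_b]; last first.
  by exists x; split=> // e; apply: xB; apply/negPn; rewrite all_b.
have [d [d0 dfeas [e nb be]]] := raise_step feas nb0.
apply: (IH _ _ _ (filled_raise xf d0 dfeas)).
rewrite -ltnS (leq_trans _ card_le) //; apply: proper_card.
apply/properP; split; last by exists e; rewrite !inE ?be.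
apply/fintype.subsetP => f; rewrite !inE; exact/contra/frozen_raise.
Qed.

End FairFilling.

(** * Stable assignments as fair allocations *)

(** With a single vertex of quota [c] and capacities [z], the fair allocation is
    [z] cut at a level: the vertex cannot serve all of [z], so it is a bottleneck
    for some edge, and the value of that edge is the level. *)
Lemma cut_level_exists {R : realFieldType} {T : finType} (z : T -> R) (c : R) :
  (forall e, 0 <= z e) -> 0 <= c < \sum_e z e ->
  exists r, 0 <= r /\ \sum_e Num.min r (z e) = c.
Proof.
move=> z0 /andP[c0 cz].
have [x [[xb xq] xf]] :=
  @fair_exists R T unit (fun=> predT) z (fun=> c) z0 (fun=> c0).
case: (pickP (fun e => x e != z e)) => [e ne|same]; last first.
  have := xq tt; rewrite /load (eq_bigr z) => [|e _]; last exact/eqP/negPn/negbT/same.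
  by rewrite leNgt cz.
case: (xf e) ne => [->|[[] [_ xc xmax]] _]; first by rewrite eqxx.
exists (x e); split; first by case/andP: (xb e).
rewrite -xc; apply: eq_bigr => f _; have /andP[_ fz] := xb f.
case: (xf f) => [<-|[[] [_ _ fmax]]]; first by rewrite min_r // xmax.
have -> : x f = x e by apply/eqP; rewrite eq_le xmax // fmax.
by rewrite min_l // (le_trans _ fz) // fmax.
Qed.

Section StableIsFair.
Set Implicit Arguments.
Unset Strict Implicit.
Context {R : realType} {V : finType} {E : {set {set V}}}.
Variables (b : edge E -> R) (q : V -> R).
Hypothesis q_ge0 : forall v, 0 <= q v.
Implicit Types (x : {ffun edge E -> R}) (v : V).

Definition incident v (e : edge E) := v \in ends e.

Lemma norm1_restr x v : admissible b x -> norm1 (restr v x) = load incident x v.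
Proof.
move=> xb; rewrite /norm1 /load.
transitivity (\sum_(e : star E v) x (star_edge e)); last first.
  exact: esym (big_sub (incident v) x).
apply: eq_bigr => e _; rewrite ffunE ger0_norm //.
by case/andP: (xb (star_edge e)).
Qed.

(** A fixed point [z] of the choice function cannot exceed the quota: it would
    be equal to its own cut, whose total is the quota because the cut level
    exists. *)
Lemma acceptable_restr x v : admissible b x ->
  acceptable b q v (restr v x) <-> load incident x v <= q v.
Proof.
move=> xb; rewrite -norm1_restr //; split=> [[_]|le]; last first.
  by split; [exists x | rewrite /choice_fun le].
rewrite /choice_fun; case: leP => // gt cut.
have z0 e : 0 <= restr v x e by rewrite ffunE; case/andP: (xb (star_edge e)).
have normE : norm1 (restr v x) = \sum_e restr v x e.
  by apply: eq_bigr => e _; rewrite ger0_norm.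
have [|r rq] := @cut_level_exists R _ (restr v x) (q v) z0.
  by rewrite q_ge0 -normE.
pose levels : set R :=
  [set s | 0 <= s /\ \sum_e Num.min s (restr v x e) = q v]%classic.
have [_ cq] := xgetPex (P := levels) 0 (ex_intro _ r rq).
suff: norm1 (restr v x) <= q v by rewrite leNgt gt.
by rewrite normE -[leRHS]cq -[in leLHS]cut; apply: ler_sum => e _; rewrite ffunE.
Qed.

Lemma satiated_iff x v (e : edge E) (ve : v \in ends e) : admissible b x ->
  satiated b q (restr v x) (in_star ve) <->
  (x e = b e \/ bottleneck incident q x v e).
Proof.
move=> xb; rewrite /satiated /head_set /upper_set !inE ffunE norm1_restr //=.
rewrite /bottleneck /incident ve.
have x0 f : 0 <= x f by case/andP: (xb f).
split=> [/orP[|/eqP]|[->|[_ -> xmax]]]; [|by left| |].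
- case: eqP => [vq|_]; last by rewrite inE.
  rewrite inE ffunE => /eqP xe; right; split=> // f vf; rewrite [leRHS]xe.
  have -> : x f = restr v x (in_star vf) by rewrite ffunE.
  exact: le_bigmax.
- by rewrite eqxx orbT.
- rewrite eqxx inE ffunE; apply/orP; left; rewrite eq_le; apply/andP; split.
    have -> : x (star_edge (in_star ve)) = restr v x (in_star ve) by rewrite ffunE.
    exact: le_bigmax.
  apply: bigmax_le => // f _; rewrite ffunE; apply: xmax; exact: (svalP f).
Qed.

Lemma stable_fair (F W : {set V}) x : bipartite E F W ->
  stable_assignments b q x <-> fair incident b q x.
Proof.
move=> [_ _ twoends]; split=> [[[xb xA] nblock]|[[xb xq] xf]].
  split=> [|e]; first by split=> // v; apply/acceptable_restr.
  have [i [j [_ _ eE]]] := twoends _ (svalP e).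
  have ei : i \in ends e by rewrite /ends eE set21.
  have ej : j \in ends e by rewrite /ends eE set22.
  have [/(satiated_iff ei xb)[|]|ni] := boolP (satiated b q (restr i x) (in_star ei)).
  - by left.
  - by right; exists i.
  have [/(satiated_iff ej xb)[|]|nj] := boolP (satiated b q (restr j x) (in_star ej)).
  - by left.
  - by right; exists j.
  by case: nblock; exists e, i, j, ei, ej; split.
split; first by split=> // v; apply/acceptable_restr.
move=> [e [i [j [ei [ej [eE /negP ni /negP nj]]]]]].
case: (xf e) => [xe|[v vb]]; first by apply: ni; apply/satiated_iff => //; left.
have := vb; case; rewrite /incident eE !inE => /orP[] /eqP vE _ _; subst v.
  by apply: ni; apply/satiated_iff => //; right.
by apply: nj; apply/satiated_iff => //; right.
Qed.

End StableIsFair.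

Theorem theorem3p1
    (R : realType) (V : finType) (E : {set {set V}})
    (F W : {set V}) (b : edge E -> R) (q : V -> R)
    (hG : bipartite E F W)
    (hb : forall e, 0 <= b e) (hq : forall v, 0 <= q v) :
  exists x : {ffun edge E -> R}, stable_assignments b q = [set x]%classic.
Proof.
have [x fx] := fair_exists (@incident V E) hb hq.
have fx' : fair incident b q (finfun x).
  suff -> : (finfun x : _ -> _) = x by [].
  by apply: boolp.funext => e; rewrite ffunE.
exists (finfun x); apply/seteqP; split=> [y /(stable_fair _ hq _ hG) fy|y ->] /=.
  by apply/ffunP => e; apply: fair_uniq fy fx' e.
exact/(stable_fair _ hq _ hG).
Qed.
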